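(* Let $n\ge3$ and let $\Gamma$ be the digraph of order $n^2$ whose adjacency matrix, written as an $n\times n$ array of $n\times n$ blocks, is $$A=\begin{bmatrix}0 & I_n & \cdots & I_n\\ J_n-I_n & 0 & \cdots & 0\\ \vdots & \vdots & & \vdots\\ J_n-I_n & 0&\cdots&0\end{bmatrix},$$ i.e. the block in position $(1,c)$ is $I_n$ for $c=2,\dots,n$, the block in position $(r,1)$ is $J_n-I_n$ for $r=2,\dots,n$, and all other blocks are zero. Then $\Gamma$ is a restricted-normal digraph that is not a directed join.
   Context: $I_n$ is the $n\times n$ identity and $J_n$ the $n\times n$ all-ones matrix. The Laplacian of a digraph is $L=D-A$ with $D$ the diagonal matrix of out-degrees. $\mathbf{e}$ is the all-ones vector; a restrictor matrix of order $N$ is an $N\times(N-1)$ matrix $Q$ with orthonormal columns orthogonal to $\mathbf{e}$. A digraph is restricted-normal if $L$ is not normal but $Q^*LQ$ is normal (independent of the choice of $Q$). A digraph $(V,E)$ is a directed join if there is a partition $V=V_1\sqcup V_2$ into nonempty sets such that $(i,j)\in E$ for all $i\in V_1,j\in V_2$ and there is no edge $(j,i)\in E$ with $j\in V_2,i\in V_1$. *)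

(* Defs.v *)
From HB Require Import structures.
From mathcomp Require Import all_boot all_order all_algebra.

Set Implicit Arguments.
Unset Strict Implicit.
Unset Printing Implicit Defensive.

Import Order.TTheory GRing.Theory Num.Theory.
Local Open Scope ring_scope.
Local Open Scope sesquilinear_scope.

Record digraph (N : nat) := Digraph {
  edge :> rel 'I_N;
  edge_irrefl : irreflexive edge }.

Definition outdeg (N : nat) (G : digraph N) (i : 'I_N) : nat :=
  #|[set j : 'I_N | G i j]|.

Definition adjmx (C : numClosedFieldType) (N : nat) (G : digraph N) : 'M[C]_N :=
  \matrix_(i, j) (G i j)%:R.

Definition laplacian (C : numClosedFieldType) (N : nat) (G : digraph N) :
    'M[C]_N :=
  diag_mx (\row_i (outdeg G i)%:R) - adjmx C G.

Definition restrictor (C : numClosedFieldType) (N : nat)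
    (Q : 'M[C]_(N, N.-1)) : Prop :=
  Q ^t* *m Q = 1%:M /\ Q ^t* *m (const_mx 1 : 'cV[C]_N) = 0.

(* The property of Q^* L Q does not depend on the restrictor matrix Q, and
   restrictor matrices always exist (restrictor_exists), so the universal
   quantifier is not vacuous. *)
Definition restricted_normal (C : numClosedFieldType) (N : nat)
    (G : digraph N) : Prop :=
  laplacian C G \isn't normalmx /\
  forall Q : 'M[C]_(N, N.-1), restrictor Q ->
    Q ^t* *m laplacian C G *m Q \is normalmx.

Definition directed_join (N : nat) (G : digraph N) : Prop :=
  exists V1 V2 : {set 'I_N},
    [/\ V1 :|: V2 = [set: 'I_N], [disjoint V1 & V2], V1 != set0, V2 != set0 &
        forall i j : 'I_N, i \in V1 -> j \in V2 -> G i j /\ ~~ G j i].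

Lemma sum_const_sqr (n : nat) : (\sum_(i < n) n = n ^ 2)%N.
Proof. by rewrite sum_nat_const card_ord. Qed.

Definition block_entry (C : numClosedFieldType) (n : nat) (r c : 'I_n) :
    'M[C]_n :=
  if (r == 0 :> nat) && (c != 0 :> nat) then 1%:M
  else if (r != 0 :> nat) && (c == 0 :> nat) then const_mx 1 - 1%:M
  else 0.

(* The cast only transports the block matrix from its native order
   n + ... + n to n ^ 2. *)
Definition block_adjmx (C : numClosedFieldType) (n : nat) : 'M[C]_(n ^ 2) :=
  castmx (sum_const_sqr n, sum_const_sqr n)
    (\mxblock_(r < n, c < n) block_entry C r c).

Lemma restrictor_exists (C : numClosedFieldType) (N : nat) :
  exists Q : 'M[C]_(N, N.-1), restrictor Q.
Proof.
case: N => [|N]; first by exists 0; split; apply/matrixP => - [].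
pose e : 'cV[C]_N.+1 := const_mx 1.
have rk_e : \rank e = 1%N.
  apply/eqP; rewrite eqn_leq rank_leq_col lt0n mxrank_eq0.
  by apply/eqP => /matrixP/(_ 0 0)/eqP; rewrite !mxE oner_eq0.
have rk : \rank (kermx e) = N by rewrite mxrank_ker rk_e subn1.
have [P Pu Pe] : exists2 P : 'M[C]_(\rank (kermx e), N.+1),
    P \is unitarymx & P *m e = 0.
  exists (schmidt (row_base (kermx e))).
    by rewrite schmidt_unitarymx // rank_leq_col.
  apply/sub_kermxP.
  by rewrite eqmx_schmidt_free ?row_base_free // eq_row_base.
move: P Pu Pe; rewrite rk => P /unitarymxP PP Pe.
have PK : (P ^t*) ^t* = P by apply/matrixP => i j; rewrite !mxE conjCK.
by exists (P ^t*); split; rewrite PK.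
Qed.

Lemma block_adjmx_digraph (C : numClosedFieldType) (n : nat) :
  exists G : digraph (n ^ 2), adjmx C G = block_adjmx C n.
Proof.
have entry01 (r c x y : 'I_n) :
    block_entry C r c x y = (block_entry C r c x y == 1)%:R.
  rewrite /block_entry; case: ifP => _; last case: ifP => _;
    rewrite !mxE; case: (x == y);
    by rewrite ?subrr ?subr0 ?mulr1n ?mulr0n ?eqxx // eq_sym oner_eq0.
have irr : irreflexive (fun i j => block_adjmx C n i j == 1).
  move=> i; rewrite castmxE mxE /block_entry.
  case: ifP => [/andP[/eqP-> /eqP //]|_]; case: ifP => [/andP[/eqP + /eqP //]|_].
  by rewrite mxE eq_sym oner_eq0.
exists (Digraph irr); apply/matrixP => i j.
by rewrite !mxE /= castmxE mxE -entry01.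
Qed.

(* Main.v *)
Require Import Defs.
From mathcomp Require Import all_boot all_order all_algebra.
From mathcomp Require Import ring.

(* All out-degrees are n - 1, so L = (n - 1) I - A and both normality questions
   concern A. The compression Q^* A Q is normal iff
   M = A A^* - A^* A + (A^* e) (A^* e)^* / n^2 has the form a e^* + e b^*; a
   direct computation with the blocks shows that it does, whereas the diagonal
   of A A^* - A^* A (out-degree minus in-degree) is nonzero on the first block.
   In a directed join, whichever side the vertices of the first block are on,
   some required edge between V1 and V2 is missing. *)

Set Implicit Arguments.
Unset Strict Implicit.
Unset Printing Implicit Defensive.

Import Order.TTheory GRing.Theory Num.Theory.
Local Open Scope ring_scope.
Local Open Scope sesquilinear_scope.

(** * Normality, scalar shifts and compression by a restrictor *)

Lemma trmxC_mul (C : numClosedFieldType) m n p (A : 'M[C]_(m, n))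
    (B : 'M[C]_(n, p)) : (A *m B) ^t* = B ^t* *m A ^t*.
Proof. by rewrite trmx_mul map_mxM. Qed.

Lemma trmxC_const1 (C : numClosedFieldType) m n :
  (const_mx 1 : 'M[C]_(m, n)) ^t* = const_mx 1.
Proof. by rewrite trmx_const map_const_mx rmorph1. Qed.

(** Scalar matrices commute with everything, and [B] is recovered by a second shift, so one
    implication suffices. *)
Lemma normalmx_shift (C : numClosedFieldType) n (c : C) (B : 'M[C]_n) :
  (c%:M - B \is normalmx) = (B \is normalmx).
Proof.
have shift (z : C) (M : 'M[C]_n) : M \is normalmx -> z%:M - M \is normalmx.
  move=> /normalmxP MM; apply/normalmxP.
  rewrite linearB /= map_mxB tr_scalar_mx map_scalar_mx /=.
  rewrite !mulmxBl !mulmxBr MM -!scalar_mxM [z * _]mulrC.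
  rewrite !mul_scalar_mx !mul_mx_scalar !opprB -!addrA; congr (_ + _).
  by rewrite addrCA [RHS]addrCA [- (z *: _) - _]addrC.
apply/idP/idP => [|/shift //].
by move/(shift c); rewrite opprB addrC subrK.
Qed.

(** Stacking [e ^t*] on [Q ^t*] gives a square matrix with right inverse [[e / N, Q]]; the inverse
    is two-sided, and the reversed product is the claim. *)
Lemma restrictor_mul_trmxC (C : numClosedFieldType) N (Q : 'M[C]_(N, N.-1)) :
  (0 < N)%N -> restrictor Q ->
  Q *m Q ^t* = 1%:M - N%:R^-1 *: (const_mx 1 *m (const_mx 1 : 'cV_N) ^t*).
Proof.
case: N Q => // m Q _ [QQ Qe]; rewrite trmxC_const1.
have m_neq0 : m.+1%:R != 0 :> C by rewrite pnatr_eq0.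
have eQ : (const_mx 1 : 'rV[C]_m.+1) *m Q = 0.
  by rewrite -[Q]trmxCK -trmxC_const1 -trmxC_mul Qe trmx0 map_mx0.
pose B : 'M[C]_(1 + m, 1 + m) := col_mx (const_mx 1) (Q ^t*).
pose R : 'M[C]_(1 + m, 1 + m) := row_mx (m.+1%:R^-1 *: const_mx 1) Q.
have BR : B *m R = 1%:M.
  rewrite mul_col_row -!scalemxAr QQ Qe eQ scaler0 scalar_mx_block.
  congr block_mx; apply/matrixP => i j; rewrite !mxE !ord1.
  rewrite (eq_bigr (fun=> 1)) => [|k _]; last by rewrite !mxE mulr1.
  by rewrite sumr_const card_ord mulVf.
have := mulmx1C BR; rewrite mul_row_col -scalemxAl => <-.
by rewrite addrC addKr.
Qed.

(* Since Q Q^* = 1 - e e^* / N and A e is killed by Q^*, the commutator of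
   Q^* A Q is Q^* M Q for the left-hand side M of the last hypothesis;
   matrices of the form a e^* + e b^* are exactly those that vanish under this
   compression. *)
Lemma compression_normal (C : numClosedFieldType) N (A : 'M[C]_N) (c : C)
    (a b : 'cV[C]_N) (Q : 'M[C]_(N, N.-1)) (e := const_mx 1 : 'cV[C]_N) :
  (0 < N)%N -> restrictor Q -> A *m e = c *: e ->
  A *m A ^t* - A ^t* *m A
    + N%:R^-1 *: (A ^t* *m e *m (A ^t* *m e) ^t*) = a *m e ^t* + e *m b ^t* ->
  Q ^t* *m A *m Q \is normalmx.
Proof.
move=> N_gt0 rQ Ae defA; have QQ := restrictor_mul_trmxC N_gt0 rQ.
have [_ Qe] := rQ.
have eQ : e ^t* *m Q = 0 by rewrite -[Q]trmxCK -trmxC_mul Qe trmx0 map_mx0.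
have QAe : Q ^t* *m A *m e = 0 by rewrite -mulmxA Ae -scalemxAr Qe scaler0.
apply/normalmxP/eqP; rewrite !trmxC_mul trmxCK -subr_eq0.
have -> : Q ^t* *m A *m Q *m (Q ^t* *m (A ^t* *m Q))
      = Q ^t* *m (A *m A ^t*) *m Q.
  rewrite !mulmxA -(mulmxA (Q ^t* *m A)) QQ mulmxBr mulmx1 -scalemxAr mulmxA.
  by rewrite QAe mul0mx scaler0 subr0.
(* In this order the [e e^*] part of [Q Q^*] survives, as [A ^t* *m e] need not be a multiple of
   [e]; it yields the rank-one term. *)
have -> : Q ^t* *m (A ^t* *m Q) *m (Q ^t* *m A *m Q)
    = Q ^t* *m (A ^t* *m A
        - N%:R^-1 *: (A ^t* *m e *m (A ^t* *m e) ^t*)) *m Q.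
  rewrite !mulmxA -(mulmxA (Q ^t* *m A ^t*)) QQ trmxC_mul trmxCK.
  by rewrite !(mulmxBr, mulmxBl) -!(scalemxAr, scalemxAl) mulmx1 !mulmxA.
rewrite -mulmxBl -mulmxBr opprD opprK addrA defA mulmxDr mulmxDl.
rewrite -!mulmxA eQ !mulmx0 add0r.
by rewrite mulmxA Qe mul0mx.
Qed.

(** * Block and offset coordinates of a vertex *)

(** This is the indexing built into [\mxblock], with the cast of [block_adjmx], so entries of the
    block matrix unfold directly to these coordinates. *)
Definition blk n (k : 'I_(n ^ 2)) : 'I_n :=
  tagnat.sig1 (cast_ord (esym (sum_const_sqr n)) k).

Definition off n (k : 'I_(n ^ 2)) : 'I_n :=
  tagnat.sig2 (cast_ord (esym (sum_const_sqr n)) k).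

Definition vertex n (r x : 'I_n) : 'I_(n ^ 2) :=
  cast_ord (sum_const_sqr n) (@tagnat.Rank n (fun=> n) r x).

Lemma blk_vertex n (r x : 'I_n) : blk (vertex r x) = r.
Proof. by rewrite /blk /vertex cast_ordK tagnat.Rank1K. Qed.

Lemma off_vertex n (r x : 'I_n) : off (vertex r x) = x.
Proof.
by apply: val_inj; rewrite /off /vertex cast_ordK tagnat.Rank2K.
Qed.

Lemma vertex_blk_off n (k : 'I_(n ^ 2)) : vertex (blk k) (off k) = k.
Proof. by rewrite /vertex /blk /off tagnat.sig2K cast_ordKV. Qed.

Lemma sum_blk_off (R : comPzRingType) n (f g : 'I_n -> R) :
  \sum_k f (blk k) * g (off k) = (\sum_r f r) * (\sum_x g x).
Proof.
rewrite big_distrlr pair_big (reindex (fun p => vertex p.1 p.2)) /=.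
  by apply: eq_bigr => -[r x] _; rewrite blk_vertex off_vertex.
exists (fun k => (blk k, off k)) => [[r x] _|k _].
  by rewrite blk_vertex off_vertex.
exact: vertex_blk_off.
Qed.

(** * Edges and adjacency entries in coordinates *)

Lemma edge_block (C : numClosedFieldType) n (G : digraph (n ^ 2))
    (hG : adjmx C G = block_adjmx C n) (i j : 'I_(n ^ 2)) :
  G i j = if blk i == 0 :> nat then (blk j != 0 :> nat) && (off i == off j)
          else (blk j == 0 :> nat) && (off i != off j).
Proof.
have natr_inj : injective (fun b : bool => b%:R : C).
  by apply: (can_inj (g := eq_op^~ 1)) => -[]; rewrite ?eqxx // eq_sym oner_eq0.
apply: natr_inj; have := congr1 (fun M : 'M_ _ => M i j) hG.
rewrite mxE castmxE mxE -/(blk i) -/(blk j) => ->.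
rewrite /block_entry; case: eqP => _; case: eqP => _ /=; rewrite !mxE //.
by rewrite -/(off i) -/(off j); case: eqP; rewrite ?subrr ?subr0.
Qed.

(** Taking indicators in [C] makes matrix entries polynomials, so that [ring] and [field] can
    compare them. *)
Definition ind0 (C : numClosedFieldType) n (k : 'I_n) : C := (k == 0 :> nat)%:R.

Definition ind_eq (C : numClosedFieldType) n (x y : 'I_n) : C := (x == y)%:R.

Lemma adjmx_block (C : numClosedFieldType) n (G : digraph (n ^ 2))
    (hG : adjmx C G = block_adjmx C n) (i j : 'I_(n ^ 2)) :
  adjmx C G i j =
    ind0 C (blk i) * (1 - ind0 C (blk j)) * ind_eq C (off i) (off j)
    + (1 - ind0 C (blk i)) * ind0 C (blk j) * (1 - ind_eq C (off i) (off j)).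
Proof.
rewrite mxE (edge_block hG) /ind0 /ind_eq.
by case: eqP; case: eqP; case: eqP => _ _ _ /=; ring.
Qed.

Lemma ind0_cases (C : numClosedFieldType) n (r : 'I_n) :
  ind0 C r = 0 \/ ind0 C r = 1.
Proof. by rewrite /ind0; case: eqP; [right | left]. Qed.

Lemma ind_eqC (C : numClosedFieldType) n (x y : 'I_n) :
  ind_eq C x y = ind_eq C y x.
Proof. by rewrite /ind_eq eq_sym. Qed.

(** * Sums of indicators *)

Lemma sum_ind0 (C : numClosedFieldType) n :
  (0 < n)%N -> \sum_(r < n) ind0 C r = 1.
Proof.
by case: n => // n _; rewrite big_ord_recl big1 ?addr0.
Qed.

Lemma sum_tail (C : numClosedFieldType) n :
  (0 < n)%N -> \sum_(r < n) (1 - ind0 C r) = n%:R - 1.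
Proof. by move=> n_gt0; rewrite sumrB sumr_const card_ord sum_ind0. Qed.

Lemma sum_ind_eq (C : numClosedFieldType) n (x : 'I_n) :
  \sum_y ind_eq C x y = 1.
Proof.
rewrite (bigD1 x) //= big1 => [|y /negPf yx]; rewrite /ind_eq ?eqxx ?addr0 //.
by rewrite eq_sym yx.
Qed.

Lemma sum_ind_eq2 (C : numClosedFieldType) n (x y : 'I_n) :
  \sum_z ind_eq C x z * ind_eq C y z = ind_eq C x y.
Proof.
rewrite (bigD1 x) //= big1 => [|z /negPf zx].
  by rewrite addr0 {1}/ind_eq eqxx mul1r ind_eqC.
by rewrite /ind_eq eq_sym zx mul0r.
Qed.

Lemma sum_diff (C : numClosedFieldType) n (x : 'I_n) :
  \sum_y (1 - ind_eq C x y) = n%:R - 1.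
Proof. by rewrite sumrB sumr_const card_ord sum_ind_eq. Qed.

Lemma sum_diff2 (C : numClosedFieldType) n (x y : 'I_n) :
  \sum_z (1 - ind_eq C x z) * (1 - ind_eq C y z) = n%:R - 2 + ind_eq C x y.
Proof.
have -> : n%:R - 2 + ind_eq C x y
    = (n%:R - 1) - \sum_z ind_eq C y z + \sum_z ind_eq C x z * ind_eq C y z.
  by rewrite sum_ind_eq sum_ind_eq2; ring.
by rewrite -(sum_diff C x) -sumrB -big_split; apply: eq_bigr => z _ /=; ring.
Qed.

(** * Degrees and Gram matrices of the adjacency matrix *)

Lemma trmxC_adjmx (C : numClosedFieldType) N (G : digraph N) :
  (adjmx C G) ^t* = (adjmx C G)^T.
Proof. by apply/matrixP => i j; rewrite !mxE conjC_nat. Qed.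

Lemma adjmx_row_sum (C : numClosedFieldType) n (G : digraph (n ^ 2))
    (hG : adjmx C G = block_adjmx C n) (i : 'I_(n ^ 2)) :
  (0 < n)%N -> \sum_j adjmx C G i j = n%:R - 1.
Proof.
move=> n_gt0; under eq_bigr do rewrite adjmx_block //.
rewrite big_split /=.
rewrite (sum_blk_off (fun r => _ * (1 - ind0 C r)) (ind_eq C (off i))).
rewrite (sum_blk_off (fun r => _ * ind0 C r) (fun x => 1 - ind_eq C (off i) x)).
rewrite -!mulr_sumr sum_ind0 // sum_tail // sum_ind_eq sum_diff.
by ring.
Qed.

Lemma adjmx_col_sum (C : numClosedFieldType) n (G : digraph (n ^ 2))
    (hG : adjmx C G = block_adjmx C n) (j : 'I_(n ^ 2)) :
  (0 < n)%N ->
  \sum_i adjmx C G i j = 1 - ind0 C (blk j) + ind0 C (blk j) * (n%:R - 1) ^+ 2.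
Proof.
move=> n_gt0.
rewrite (eq_bigr (fun i => ind0 C (blk i) * (1 - ind0 C (blk j))
     * ind_eq C (off j) (off i) + (1 - ind0 C (blk i)) * ind0 C (blk j)
     * (1 - ind_eq C (off j) (off i)))) => [|i _]; last first.
  by rewrite adjmx_block // ind_eqC.
rewrite big_split /= (sum_blk_off (fun r => ind0 C r * _) (ind_eq C (off j))).
rewrite (sum_blk_off (fun r => (1 - ind0 C r) * _)
  (fun x => 1 - ind_eq C (off j) x)).
rewrite -!mulr_suml sum_ind0 // sum_tail // sum_ind_eq sum_diff.
by ring.
Qed.

Lemma adjmx_mul_trmx (C : numClosedFieldType) n (G : digraph (n ^ 2))
    (hG : adjmx C G = block_adjmx C n) (i j : 'I_(n ^ 2))
    (u := ind0 C (blk i)) (v := ind0 C (blk j))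
    (d := ind_eq C (off i) (off j)) :
  (0 < n)%N ->
  (adjmx C G *m (adjmx C G)^T) i j =
    u * v * (n%:R - 1) * d + (1 - u) * (1 - v) * (n%:R - 2 + d).
Proof.
move=> n_gt0; rewrite mxE.
(* The mixed products carry [ind0 * (1 - ind0)] at [blk k], which vanishes; each remaining term
   splits into a block factor and an offset factor. *)
rewrite (eq_bigr (fun k => u * v * (1 - ind0 C (blk k))
    * (ind_eq C (off i) (off k) * ind_eq C (off j) (off k))
  + (1 - u) * (1 - v) * ind0 C (blk k)
    * ((1 - ind_eq C (off i) (off k)) * (1 - ind_eq C (off j) (off k))))).
  rewrite big_split /= (sum_blk_off (fun r => _ * (1 - ind0 C r))
    (fun x => ind_eq C (off i) x * ind_eq C (off j) x)).
  rewrite (sum_blk_off (fun r => _ * ind0 C r)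
    (fun x => (1 - ind_eq C (off i) x) * (1 - ind_eq C (off j) x))).
  rewrite -!mulr_sumr sum_ind0 // sum_tail // sum_ind_eq2 sum_diff2 -/d.
  by ring.
move=> k _; rewrite [_^T _ _]mxE !adjmx_block //.
by rewrite -/u -/v; case: (ind0_cases C (blk k)) => ->; ring.
Qed.

Lemma trmx_mul_adjmx (C : numClosedFieldType) n (G : digraph (n ^ 2))
    (hG : adjmx C G = block_adjmx C n) (i j : 'I_(n ^ 2))
    (u := ind0 C (blk i)) (v := ind0 C (blk j))
    (d := ind_eq C (off i) (off j)) :
  (0 < n)%N ->
  ((adjmx C G)^T *m adjmx C G) i j =
    (1 - u) * (1 - v) * d + u * v * (n%:R - 1) * (n%:R - 2 + d).
Proof.
move=> n_gt0; rewrite mxE.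
rewrite (eq_bigr (fun k => (1 - u) * (1 - v) * ind0 C (blk k)
    * (ind_eq C (off i) (off k) * ind_eq C (off j) (off k))
  + u * v * (1 - ind0 C (blk k))
    * ((1 - ind_eq C (off i) (off k)) * (1 - ind_eq C (off j) (off k))))).
  rewrite big_split /= (sum_blk_off (fun r => _ * ind0 C r)
    (fun x => ind_eq C (off i) x * ind_eq C (off j) x)).
  rewrite (sum_blk_off (fun r => _ * (1 - ind0 C r))
    (fun x => (1 - ind_eq C (off i) x) * (1 - ind_eq C (off j) x))).
  rewrite -!mulr_sumr sum_ind0 // sum_tail // sum_ind_eq2 sum_diff2 -/d.
  by ring.
move=> k _; rewrite [_^T _ _]mxE !adjmx_block // ![ind_eq C (off k) _]ind_eqC.
by rewrite -/u -/v; case: (ind0_cases C (blk k)) => ->; ring.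
Qed.

(** * Restricted normality and the absence of a directed join *)

Lemma laplacian_block (C : numClosedFieldType) n (G : digraph (n ^ 2))
    (hG : adjmx C G = block_adjmx C n) :
  (0 < n)%N -> laplacian C G = (n%:R - 1)%:M - adjmx C G.
Proof.
move=> n_gt0; congr (_ - _); apply/matrixP => i j; rewrite !mxE.
rewrite -(adjmx_row_sum hG i n_gt0) /outdeg -sum1_card natr_sum.
congr (_ *+ _); rewrite big_mkcond; apply: eq_bigr => k _.
by rewrite inE mxE; case: (G i k).
Qed.

Lemma adjmx_not_normal (C : numClosedFieldType) n (G : digraph (n ^ 2))
    (hG : adjmx C G = block_adjmx C n) :
  (3 <= n)%N -> adjmx C G \isn't normalmx.
Proof.
move=> n_ge3; have n_gt0 : (0 < n)%N by apply: leq_trans n_ge3.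
apply/negP => /normalmxP; rewrite trmxC_adjmx.
(* At a first-block vertex the diagonal entries are [n - 1] and [(n - 1)^2]; they differ by
   [(n - 1)(n - 2)], nonzero for [n >= 3]. *)
pose i := vertex (Ordinal n_gt0) (Ordinal n_gt0).
move/matrixP/(_ i i); rewrite adjmx_mul_trmx // trmx_mul_adjmx //.
rewrite blk_vertex off_vertex /ind0 /ind_eq !eqxx /= => /eqP.
rewrite -subr_eq0 -oppr_eq0.
have -> : (- (1 * 1 * (n%:R - 1) * 1 + (1 - 1) * (1 - 1) * (n%:R - 2 + 1)
   - ((1 - 1) * (1 - 1) * 1 + 1 * 1 * (n%:R - 1) * (n%:R - 2 + 1))))
   = (n%:R - 1) * (n%:R - 2) :> C by ring.
by rewrite mulf_eq0 !subr_eq0 pnatr_eq1 eqr_nat !gtn_eqF // ltnW.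
Qed.

Lemma adjmx_compression_normal (C : numClosedFieldType) n (G : digraph (n ^ 2))
    (hG : adjmx C G = block_adjmx C n) (Q : 'M[C]_(n ^ 2, (n ^ 2).-1)) :
  (0 < n)%N -> restrictor Q -> Q ^t* *m adjmx C G *m Q \is normalmx.
Proof.
move=> n_gt0 rQ; have n_neq0 : n%:R != 0 :> C by rewrite pnatr_eq0 -lt0n.
(* The (i, j) entry of M is a bilinear polynomial in the indicators
   u_i, u_j of the first block, independent of the offsets. Its u_i u_j
   coefficient is (n - 2) (1 - (n - 1)) + (n - 2)^2 = 0, hence a and b. *)
pose t : C := (n%:R - 2) / n%:R - (n%:R - 2).
pose a : 'cV[C]_(n ^ 2) :=
  \col_i (t * ind0 C (blk i) + (n%:R - 2) + n%:R ^- 2).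
pose b : 'cV[C]_(n ^ 2) := \col_i (t * ind0 C (blk i)).
apply: (compression_normal (c := n%:R - 1) (a := a) (b := b)) => //.
- by rewrite expn_gt0 n_gt0.
- apply/matrixP => i j; rewrite !mxE mulr1 -(adjmx_row_sum hG i n_gt0).
  by apply: eq_bigr => k _; rewrite [const_mx _ _ _]mxE mulr1.
have colE i : ((adjmx C G)^T *m (const_mx 1 : 'cV_(n ^ 2))) i 0
    = 1 - ind0 C (blk i) + ind0 C (blk i) * (n%:R - 1) ^+ 2.
  rewrite -(adjmx_col_sum hG) // mxE; apply: eq_bigr => k _.
  by rewrite [const_mx _ _ _]mxE mulr1 mxE.
have ind0R (r : 'I_n) : (ind0 C r)^* = ind0 C r by rewrite conjC_nat.
rewrite trmxC_adjmx trmxC_const1.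
have rowE i j := adjmx_mul_trmx hG i j n_gt0.
have gramE i j := trmx_mul_adjmx hG i j n_gt0.
set A := adjmx C G in colE rowE gramE *.
(* Generalizing the products keeps [mxE] from expanding them into sums. *)
move: (A^T *m A) (A *m A^T) (A^T *m (const_mx 1 : 'cV_(n ^ 2))) rowE gramE colE.
move=> K R w RE KE wE.
apply/matrixP => i j; rewrite !mxE !big_ord1 !mxE RE KE !wE natrX.
rewrite !(rmorphD, rmorphB, rmorphM, rmorphXn, rmorph1, fmorphV) /=.
by rewrite !(ind0R, conjC_nat, rmorph1) /t; field.
Qed.

Lemma not_directed_join_block (C : numClosedFieldType) n (G : digraph (n ^ 2))
    (hG : adjmx C G = block_adjmx C n) :
  (2 <= n)%N -> ~ directed_join G.
Proof.
move=> n_ge2 [V1 [V2 [VU _ /set0Pn[i iV1] /set0Pn[j jV2] V12]]].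
have n_gt0 : (0 < n)%N by apply: ltnW.
have V2_of k : k \notin V1 -> k \in V2.
  by move=> kV1; have := in_setT k; rewrite -VU inE (negPf kV1).
(* A first-block vertex only has edges to its own offset, so at most one of them can lie in [V1]. *)
have jump x : vertex (Ordinal n_gt0) x \in V1 -> off j = x.
  move=> xV1; have [] := V12 _ _ xV1 jV2.
  by rewrite (edge_block hG) blk_vertex off_vertex /= => /andP[_ /eqP].
(* Edges into the first block come from other blocks and change the offset. *)
have stuck x : vertex (Ordinal n_gt0) x \in V2 -> off i != x.
  move=> xV2; have [+ _] := V12 _ _ iV1 xV2.
  by rewrite (edge_block hG) blk_vertex off_vertex /=; case: eqP.
have inV1 : vertex (Ordinal n_gt0) (off i) \in V1.
  by apply: contraT => /V2_of/stuck; rewrite eqxx.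
have [x xi] : exists x : 'I_n, x != off i.
  have /card_gt1P[x [y [_ _ xy]]] : (1 < #|'I_n|)%N by rewrite card_ord.
  case: (eqVneq x (off i)) xy => [->|? _]; last by exists x.
  by exists y; rewrite eq_sym.
have [/jump|/V2_of xV2] := boolP (vertex (Ordinal n_gt0) x \in V1).
  by rewrite (jump _ inV1) => ix; rewrite ix eqxx in xi.
(* This would be an edge inside the first block, where there is none. *)
have [+ _] := V12 _ _ inV1 xV2.
by rewrite (edge_block hG) !blk_vertex.
Qed.

Theorem theorem3p12 (C : numClosedFieldType) (n : nat) (hn : (3 <= n)%N)
    (G : digraph (n ^ 2)) (hG : adjmx C G = block_adjmx C n) :
  restricted_normal C G /\ ~ directed_join G.
Proof.
have n_gt0 : (0 < n)%N by apply: leq_trans hn.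
split; last by apply: (not_directed_join_block hG); apply: ltnW.
rewrite /restricted_normal laplacian_block //; split.
  by rewrite normalmx_shift adjmx_not_normal.
move=> Q rQ; have [QQ _] := rQ.
(* Since [Q ^t* *m Q = 1], the scalar part of the Laplacian compresses to the same scalar. *)
rewrite mulmxBr mulmxBl mul_mx_scalar -scalemxAl QQ scalemx1 normalmx_shift.
exact: adjmx_compression_normal.
Qed.
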